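(* (The First Isomorphism Theorem) If $\varphi\colon G\to H$ is a gyrogroup homomorphism, then $G/\ker\varphi\cong\varphi(G)$ as gyrogroups.
   Context: A gyrogroup is a nonempty set $G$ with a binary operation $\oplus$ such that: (G1) there is $0\in G$ with $0\oplus a=a$ for all $a$; (G2) for each $a$ there is $b$ with $b\oplus a=0$; (G3) for all $a,b\in G$ there is an automorphism $\mathrm{gyr}[a,b]$ of $(G,\oplus)$ (a bijection $G\to G$ preserving $\oplus$) with $a\oplus(b\oplus c)=(a\oplus b)\oplus\mathrm{gyr}[a,b]c$ for all $c\in G$; (G4) $\mathrm{gyr}[a,b]=\mathrm{gyr}[a\oplus b,b]$ for all $a,b\in G$. It is known that $0$ is a two-sided identity and every $a$ has a two-sided inverse $\ominus a$. A gyrogroup homomorphism is a map $\varphi\colon G\to H$ between gyrogroups with $\varphi(a\oplus b)=\varphi(a)\oplus\varphi(b)$ for all $a,b\in G$; its kernel is $\ker\varphi=\varphi^{-1}(\{0\})$, and its image $\varphi(G)$ is a gyrogroup under the operation inherited from $H$. Two gyrogroups are isomorphic ($\cong$) if there is a bijective gyrogroup homomorphism between them. $G/\ker\varphi$ is the set of left cosets $a\oplus\ker\varphi=\{a\oplus k:k\in\ker\varphi\}$, $a\in G$, with the well-defined operation $(a\oplus\ker\varphi)\oplus(b\oplus\ker\varphi)=(a\oplus b)\oplus\ker\varphi$, under which it is a gyrogroup (the quotient gyrogroup). *)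

(* Defs.v *)
From HB Require Import structures.
From mathcomp Require Import all_boot.
From mathcomp Require Import boolp classical_sets.

Set Implicit Arguments.
Unset Strict Implicit.
Unset Printing Implicit Defensive.

Local Open Scope classical_set_scope.

Declare Scope gyro_scope.
Delimit Scope gyro_scope with gyro.
Local Open Scope gyro_scope.

(* The identity and the gyrations are recorded as data; both are uniquely
   determined by the operation (by left cancellation, [gaddI] below).
   [gyr a b] being an automorphism is [gyr_bij] together with [gyrD]. *)
HB.mixin Record isGyrogroup (G : Type) := {
  gzero : G;
  gadd : G -> G -> G;
  gyr : G -> G -> G -> G;
  gadd0g : left_id gzero gadd;
  gaddNg_ex : forall a : G, exists b : G, gadd b a = gzero;
  gyr_bij : forall a b : G, bijective (gyr a b);
  gyrD : forall a b : G, {morph gyr a b : x y / gadd x y};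
  gaddA_gyr : forall a b c : G,
    gadd a (gadd b c) = gadd (gadd a b) (gyr a b c);
  gyr_loop : forall a b : G, gyr a b =1 gyr (gadd a b) b
}.

#[short(type="gyrogroupType")]
HB.structure Definition Gyrogroup := { G of isGyrogroup G }.

Notation "x ⊕ y" := (gadd x y) (at level 50, left associativity) : gyro_scope.

HB.mixin Record isGyroHom (G H : gyrogroupType) (phi : G -> H) := {
  gyrohomD : {morph phi : a b / a ⊕ b}
}.

HB.structure Definition GyroHom (G H : gyrogroupType) :=
  { phi of isGyroHom G H phi }.

Notation "{ 'gyrohom' G -> H }" := (GyroHom.type G H)
  (at level 0, G at level 98, H at level 99, format "{ 'gyrohom'  G  ->  H }")
  : type_scope.

Definition gyro_isomorphic (G H : gyrogroupType) : Prop :=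
  exists f : {gyrohom G -> H}, bijective f.

Notation "G ≅ H" := (gyro_isomorphic G H) (at level 70) : gyro_scope.

Section GyrogroupTheory.
Variable G : gyrogroupType.
Implicit Types a b c : G.

Lemma gaddI a : injective (gadd a).
Proof.
move=> b c eq_abc; have [n na0] := gaddNg_ex a.
apply: (bij_inj (gyr_bij n a)).
by rewrite -[LHS]gadd0g -[RHS]gadd0g -na0 -!gaddA_gyr eq_abc.
Qed.

Lemma gaddKl a n : n ⊕ a = gzero -> cancel (gadd a) (gadd n).
Proof.
move=> na0 c; rewrite gaddA_gyr na0 gadd0g gyr_loop na0.
by apply: (@gaddI a); rewrite -[in RHS](gadd0g (a ⊕ c)) gaddA_gyr gadd0g.
Qed.

Lemma gaddg0 : right_id (gzero : G) gadd.
Proof.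
move=> a; have [n na0] := gaddNg_ex a.
by apply: (@gaddI n); rewrite (gaddKl na0) na0.
Qed.

Lemma gadd_solve a b : exists x, a ⊕ x = b.
Proof.
have [n na0] := gaddNg_ex a; have [m mn0] := gaddNg_ex n.
have ma : m = a by have := gaddKl mn0 a; rewrite na0 gaddg0.
by exists (n ⊕ b); rewrite -{1}ma (gaddKl mn0).
Qed.

End GyrogroupTheory.

Section GyroHomTheory.
Variables (G H : gyrogroupType) (phi : {gyrohom G -> H}).

Lemma gyrohom0 : phi gzero = gzero.
Proof. by apply: (@gaddI H (phi gzero)); rewrite -gyrohomD !gaddg0. Qed.

Lemma gyrohom_gyr a b c : phi (gyr a b c) = gyr (phi a) (phi b) (phi c).
Proof.
apply: (@gaddI H (phi a ⊕ phi b)).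
by rewrite -gaddA_gyr -!gyrohomD -gaddA_gyr.
Qed.

End GyroHomTheory.

Section Image.
Variables (G H : gyrogroupType) (phi : {gyrohom G -> H}).

Definition gyroimage : Type := set_type (range phi).

Implicit Types x y z : gyroimage.

Lemma gyroimage0_subproof : (gzero : H) \in range phi.
Proof. by apply: mem_set; exists gzero => //; exact: gyrohom0. Qed.

Lemma gyroimageD_subproof x y : val x ⊕ val y \in range phi.
Proof.
have [a _ <-] := set_valP x; have [b _ <-] := set_valP y.
by apply: mem_set; exists (a ⊕ b) => //; exact: gyrohomD.
Qed.

Lemma gyroimage_gyr_subproof x y z : gyr (val x) (val y) (val z) \in range phi.
Proof.
have [a _ <-] := set_valP x; have [b _ <-] := set_valP y.
have [c _ <-] := set_valP z.
by apply: mem_set; exists (gyr a b c) => //; exact: gyrohom_gyr.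
Qed.

Definition gyroimage_zero : gyroimage := SigSub gyroimage0_subproof.
Definition gyroimage_add x y : gyroimage := SigSub (gyroimageD_subproof x y).
Definition gyroimage_gyr x y z : gyroimage :=
  SigSub (gyroimage_gyr_subproof x y z).

Lemma gyroimage_add0 : left_id gyroimage_zero gyroimage_add.
Proof. by move=> x; apply: val_inj; exact: gadd0g. Qed.

Lemma gyroimage_addN x : exists y, gyroimage_add y x = gyroimage_zero.
Proof.
have [a _ ax] := set_valP x; have [b ba0] := gaddNg_ex a.
have pb : phi b \in range phi by apply: mem_set; exists b.
exists (SigSub pb); apply: val_inj => /=.
by rewrite -ax -gyrohomD ba0 gyrohom0.
Qed.

Lemma gyroimage_gyr_bij x y : bijective (gyroimage_gyr x y).
Proof.
have [g gK Kg] := gyr_bij (val x) (val y).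
have gP z : g (val z) \in range phi.
  have [a _ ax] := set_valP x; have [b _ bx] := set_valP y.
  have [c _ cz] := set_valP z; have [g' _ Kg'] := gyr_bij a b.
  apply: mem_set; exists (g' c) => //.
  by rewrite -[LHS]gK -ax -bx -gyrohom_gyr Kg' cz.
exists (fun z => SigSub (gP z)) => z; apply: val_inj; [exact: gK|exact: Kg].
Qed.

Lemma gyroimage_gyrD x y :
  {morph gyroimage_gyr x y : u v / gyroimage_add u v}.
Proof. by move=> u v; apply: val_inj; exact: gyrD. Qed.

Lemma gyroimage_addA x y z : gyroimage_add x (gyroimage_add y z) =
  gyroimage_add (gyroimage_add x y) (gyroimage_gyr x y z).
Proof. by apply: val_inj; exact: gaddA_gyr. Qed.

Lemma gyroimage_loop x y :
  gyroimage_gyr x y =1 gyroimage_gyr (gyroimage_add x y) y.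
Proof. by move=> z; apply: val_inj; exact: gyr_loop. Qed.

HB.instance Definition _ := isGyrogroup.Build gyroimage
  gyroimage_add0 gyroimage_addN gyroimage_gyr_bij gyroimage_gyrD
  gyroimage_addA gyroimage_loop.

End Image.

Section Quotient.
Variables (G H : gyrogroupType) (phi : {gyrohom G -> H}).

Definition gyroker : set G := phi @^-1` [set gzero].

Definition gyrocoset (a : G) : set G := [set a ⊕ k | k in gyroker].

Definition gyroquo : Type := set_type (range gyrocoset).

Implicit Types A B C : gyroquo.

Lemma gyroquo_pi_subproof a : gyrocoset a \in range gyrocoset.
Proof. by apply: mem_set; exists a. Qed.

Definition gyroquo_pi a : gyroquo := SigSub (gyroquo_pi_subproof a).

Lemma gyroquo_pi_surj A : exists a, gyroquo_pi a = A.
Proof. by have [a _ aA] := set_valP A; exists a; apply: val_inj. Qed.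

Lemma gyroquo_piP a b : gyroquo_pi a = gyroquo_pi b <-> phi a = phi b.
Proof.
split=> [/(congr1 val) /= eq_ab | eq_ab].
  have : gyrocoset a a by exists gzero; [exact: gyrohom0|exact: gaddg0].
  by rewrite eq_ab => -[k k0 <-]; rewrite gyrohomD k0 gaddg0.
suff sub c d : phi c = phi d -> gyrocoset c `<=` gyrocoset d.
  by apply: val_inj; apply/seteqP; split; exact: sub.
move=> eq_cd _ [k k0 <-]; have [x dx] := gadd_solve d (c ⊕ k).
exists x => //; apply: (@gaddI H (phi d)).
by rewrite -gyrohomD dx gyrohomD k0 eq_cd.
Qed.

Definition gyroquo_repr A : G := projT1 (cid (gyroquo_pi_surj A)).

Lemma gyroquo_reprK : cancel gyroquo_repr gyroquo_pi.
Proof. by move=> A; rewrite /gyroquo_repr; case: cid. Qed.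

Lemma gyroquo_piK a : phi (gyroquo_repr (gyroquo_pi a)) = phi a.
Proof. by apply/gyroquo_piP; rewrite gyroquo_reprK. Qed.

(* The operations go through chosen representatives; independence of the
   choice is [gyroquo_piD] and [gyroquo_pi_gyr]. *)
Definition gyroquo_add A B : gyroquo :=
  gyroquo_pi (gyroquo_repr A ⊕ gyroquo_repr B).

Definition gyroquo_gyr A B C : gyroquo :=
  gyroquo_pi (gyr (gyroquo_repr A) (gyroquo_repr B) (gyroquo_repr C)).

Lemma gyroquo_piD a b :
  gyroquo_add (gyroquo_pi a) (gyroquo_pi b) = gyroquo_pi (a ⊕ b).
Proof. by apply/gyroquo_piP; rewrite !gyrohomD !gyroquo_piK. Qed.

Lemma gyroquo_pi_gyr a b c :
  gyroquo_gyr (gyroquo_pi a) (gyroquo_pi b) (gyroquo_pi c) =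
  gyroquo_pi (gyr a b c).
Proof. by apply/gyroquo_piP; rewrite !gyrohom_gyr !gyroquo_piK. Qed.

Lemma gyroquo_add0 : left_id (gyroquo_pi gzero) gyroquo_add.
Proof.
by move=> A; have [a <-] := gyroquo_pi_surj A; rewrite gyroquo_piD gadd0g.
Qed.

Lemma gyroquo_addN A : exists B, gyroquo_add B A = gyroquo_pi gzero.
Proof.
have [a <-] := gyroquo_pi_surj A; have [b ba0] := gaddNg_ex a.
by exists (gyroquo_pi b); rewrite gyroquo_piD ba0.
Qed.

Lemma gyroquo_gyr_bij A B : bijective (gyroquo_gyr A B).
Proof.
have [a <-] := gyroquo_pi_surj A; have [b <-] := gyroquo_pi_surj B.
have [g _ Kg] := gyr_bij a b.
have Kgq : cancel (fun C => gyroquo_pi (g (gyroquo_repr C)))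
    (gyroquo_gyr (gyroquo_pi a) (gyroquo_pi b)).
  by move=> C; rewrite gyroquo_pi_gyr Kg gyroquo_reprK.
exists (fun C => gyroquo_pi (g (gyroquo_repr C))) => // C.
have inj : injective (gyroquo_gyr (gyroquo_pi a) (gyroquo_pi b)).
  move=> D E; have [d <-] := gyroquo_pi_surj D.
  have [e <-] := gyroquo_pi_surj E.
  rewrite !gyroquo_pi_gyr => /gyroquo_piP; rewrite !gyrohom_gyr.
  by move=> /(bij_inj (gyr_bij _ _)) eq_de; apply/gyroquo_piP.
by apply: inj; rewrite Kgq.
Qed.

Lemma gyroquo_gyrD A B : {morph gyroquo_gyr A B : C D / gyroquo_add C D}.
Proof.
move=> C D; have [a <-] := gyroquo_pi_surj A; have [b <-] := gyroquo_pi_surj B.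
have [c <-] := gyroquo_pi_surj C; have [d <-] := gyroquo_pi_surj D.
by rewrite gyroquo_piD !gyroquo_pi_gyr gyroquo_piD gyrD.
Qed.

Lemma gyroquo_addA A B C : gyroquo_add A (gyroquo_add B C) =
  gyroquo_add (gyroquo_add A B) (gyroquo_gyr A B C).
Proof.
have [a <-] := gyroquo_pi_surj A; have [b <-] := gyroquo_pi_surj B.
have [c <-] := gyroquo_pi_surj C.
by rewrite gyroquo_pi_gyr !gyroquo_piD gaddA_gyr.
Qed.

Lemma gyroquo_loop A B : gyroquo_gyr A B =1 gyroquo_gyr (gyroquo_add A B) B.
Proof.
move=> C; have [a <-] := gyroquo_pi_surj A; have [b <-] := gyroquo_pi_surj B.
have [c <-] := gyroquo_pi_surj C.
by rewrite gyroquo_piD !gyroquo_pi_gyr gyr_loop.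
Qed.

HB.instance Definition _ := isGyrogroup.Build gyroquo
  gyroquo_add0 gyroquo_addN gyroquo_gyr_bij gyroquo_gyrD
  gyroquo_addA gyroquo_loop.

End Quotient.

(* Main.v *)
From HB Require Import structures.
From mathcomp Require Import all_boot.
From mathcomp Require Import boolp classical_sets.
Require Import Defs.

Local Open Scope gyro_scope.

(** Two cosets of the kernel agree exactly when [phi] takes the same value at
    their representatives ([gyroquo_piP]). Read from left to right, this makes
    the map sending the coset of [a] to [phi a] well defined; read from right to
    left, it makes that map injective. It reaches every element of the image by
    construction, and it is additive because [phi] is. The coset map
    [gyroquo_pi] is onto, so each of these properties need only be checked on
    cosets of given elements, where [gyrohom_factor_pi] computes the map. *)

Section Factor.
Variables (G H : gyrogroupType) (phi : {gyrohom G -> H}).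

Lemma gyroimage_in_subproof (a : G) : phi a \in range phi.
Proof. by apply: mem_set; exists a. Qed.

Definition gyroimage_in (a : G) : gyroimage phi :=
  SigSub (gyroimage_in_subproof a).

Lemma gyroimage_in_surj (x : gyroimage phi) : exists a, gyroimage_in a = x.
Proof. by have [a _ ax] := set_valP x; exists a; apply: val_inj. Qed.

Definition gyrohom_factor (A : gyroquo phi) : gyroimage phi :=
  gyroimage_in (gyroquo_repr A).

(** The value does not depend on the chosen representative: this is what
    characterises the factorisation of [phi] through its kernel. *)
Lemma gyrohom_factor_pi (a : G) :
  gyrohom_factor (gyroquo_pi phi a) = gyroimage_in a.
Proof. by apply: val_inj; exact: gyroquo_piK. Qed.

Lemma gyrohom_factorD : {morph gyrohom_factor : A B / A ⊕ B}.
Proof.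
move=> A B; have [a <-] := gyroquo_pi_surj A; have [b <-] := gyroquo_pi_surj B.
rewrite [gyroquo_pi phi a ⊕ _]gyroquo_piD !gyrohom_factor_pi.
by apply: val_inj; exact: gyrohomD.
Qed.

Lemma gyrohom_factor_inj : injective gyrohom_factor.
Proof.
move=> A B; have [a <-] := gyroquo_pi_surj A; have [b <-] := gyroquo_pi_surj B.
by rewrite !gyrohom_factor_pi => /(congr1 val) eq_ab; apply/gyroquo_piP.
Qed.

(** An inverse needs a preimage in [G] for each element of the image, hence
    choice; injectivity then makes the right inverse two-sided. *)
Lemma gyrohom_factor_bij : bijective gyrohom_factor.
Proof.
pose g x := gyroquo_pi phi (projT1 (cid (gyroimage_in_surj x))).
have Kg : cancel g gyrohom_factor.
  by move=> x; rewrite /g gyrohom_factor_pi; case: cid.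
by exists g => // A; apply: gyrohom_factor_inj; rewrite Kg.
Qed.

HB.instance Definition _ :=
  isGyroHom.Build (gyroquo phi) (gyroimage phi) gyrohom_factor gyrohom_factorD.

End Factor.

Theorem theorem5p6 (G H : gyrogroupType) (phi : {gyrohom G -> H}) :
  gyroquo phi ≅ gyroimage phi.
Proof. by exists (gyrohom_factor G H phi); exact: gyrohom_factor_bij. Qed.
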